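(* Let $\mathbb F_q$ be a finite field with $q$ elements of characteristic $p$ and let $G$ be a finite abelian group with exponent $n$. Write $G=Syl_p(G)\times H$, where $Syl_p(G)$ is the Sylow $p$-subgroup of $G$, and let $m$ be the exponent of $H$. Let $v$ be an integer with $v^2\equiv 1\pmod n$ and $v\not\equiv 1\pmod n$, and equip $\mathbb F_qG$ with the involution $*=\sigma_1:\mathbb F_qG\to\mathbb F_qG$, $\sum_{g\in G}a_gg\mapsto\sum_{g\in G}a_gg^v$. Then $\mathbb F_qG$ is $*$-clean if and only if there exists a positive integer $t$ such that $q^t\equiv v\pmod m$.
   Context: $G$ is written multiplicatively, and $H$ is the subgroup of $G$ of order prime to $p$ complementing $Syl_p(G)$. A $*$-ring is a ring $R$ with a map $*:R\to R$ (an involution) satisfying $(x+y)^*=x^*+y^*$, $(xy)^*=y^*x^*$ and $(x^* )^*=x$ for all $x,y\in R$. A projection in a $*$-ring is an element $e$ with $e^*=e=e^2$. A $*$-ring is called $*$-clean if each of its elements is the sum of a unit and a projection. $\mathbb F_qG$ denotes the group ring of $G$ over $\mathbb F_q$. *)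

(* Defs.v *)
From HB Require Import structures.
From mathcomp Require Import all_boot all_order all_algebra all_fingroup all_solvable.

Set Implicit Arguments.
Unset Strict Implicit.
Unset Printing Implicit Defensive.

Import GroupScope GRing.Theory.
Local Open Scope ring_scope.

Record ring_involution (R : pzRingType) := RingInvolution {
  star_fun :> R -> R;
  starD : forall x y, star_fun (x + y) = star_fun x + star_fun y;
  starM : forall x y, star_fun (x * y) = star_fun y * star_fun x;
  starK : forall x, star_fun (star_fun x) = x }.

Definition is_projection (R : pzRingType) (star : ring_involution R) (e : R) :=
  star e = e /\ e ^+ 2 = e.

Definition star_clean (R : unitRingType) (star : ring_involution R) :=
  forall x : R, exists u e : R,
    [/\ u \is a GRing.unit, is_projection star e & x = u + e].

(* The multiplicative group gT is taken as a whole type; a formal sum          *)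
(* \sum_g a_g g is its coefficient function g |-> a_g. This alias keeps the    *)
(* pointwise addition of finite functions but replaces their pointwise product *)
(* by convolution.                                                             *)
Definition group_ring_of (R : nzRingType) (gT : finGroupType) : Type :=
  {ffun gT -> R}.

Section GroupRing.
Variables (R : nzRingType) (gT : finGroupType).
Local Notation RG := (group_ring_of R gT).

HB.instance Definition _ := GRing.Zmodule.copy RG {ffun gT -> R}.

(* The formal sum with the single term a g *)
Definition gr_mono (a : R) (g : gT) : RG := [ffun h => if h == g then a else 0].

Definition gr_mul (x y : RG) : RG :=
  [ffun g : gT => \sum_(h : gT) x h * y (h^-1 * g)%g].

Lemma gr_sum_monoE (x : RG) : x = \sum_g gr_mono (x g) g.
Proof.
apply/ffunP=> h; rewrite (@sum_ffunE _ _ _ _ _ (fun g => gr_mono (x g) g)).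
rewrite (bigD1 h) //= ffunE eqxx big1 ?addr0 // => g /negPf gh.
by rewrite ffunE eq_sym gh.
Qed.

Lemma gr_mulA : associative gr_mul.
Proof.
move=> x y z; apply/ffunP=> g; rewrite !ffunE.
under [RHS]eq_bigr do rewrite ffunE mulr_suml.
rewrite exchange_big /=; apply: eq_bigr => k _.
rewrite ffunE mulr_sumr [RHS](reindex_inj (mulgI k)) /=.
by apply: eq_bigr => h _; rewrite mulKg invMg !mulrA mulgA.
Qed.

Lemma gr_mul1r : left_id (gr_mono 1 1%g) gr_mul.
Proof.
move=> x; apply/ffunP=> g; rewrite ffunE (bigD1 1%g) //= ffunE eqxx mul1r.
rewrite invg1 mul1g big1 ?addr0 // => h /negPf h1.
by rewrite ffunE h1 mul0r.
Qed.

Lemma gr_mulr1 : right_id (gr_mono 1 1%g) gr_mul.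
Proof.
move=> x; apply/ffunP=> g; rewrite ffunE (bigD1 g) //= ffunE mulVg eqxx mulr1.
rewrite big1 ?addr0 // => h hg.
by rewrite ffunE -eq_mulVg1 (negPf hg) mulr0.
Qed.

Lemma gr_mulDl : left_distributive gr_mul +%R.
Proof.
move=> x y z; apply/ffunP=> g; rewrite !ffunE -big_split /=.
by apply: eq_bigr => h _; rewrite ffunE mulrDl.
Qed.

Lemma gr_mulDr : right_distributive gr_mul +%R.
Proof.
move=> x y z; apply/ffunP=> g; rewrite !ffunE -big_split /=.
by apply: eq_bigr => h _; rewrite ffunE mulrDr.
Qed.

Lemma gr_oner_neq0 : gr_mono 1 1%g != 0.
Proof.
by apply/eqP=> /ffunP/(_ 1%g) /eqP; rewrite !ffunE eqxx oner_eq0.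
Qed.

HB.instance Definition _ := GRing.Zmodule_isNzRing.Build RG
  gr_mulA gr_mul1r gr_mulr1 gr_mulDl gr_mulDr gr_oner_neq0.

Lemma gr_mulE (x y : RG) g : (x * y) g = \sum_h x h * y (h^-1 * g)%g.
Proof. by rewrite ffunE. Qed.

Lemma gr_monoM a b g h :
  gr_mono a g * gr_mono b h = gr_mono (a * b) (g * h)%g.
Proof.
apply/ffunP=> k; rewrite gr_mulE (bigD1 g) //= !ffunE eqxx big1 ?addr0.
  by rewrite -(inj_eq (mulgI g)) mulKVg; case: eqP; rewrite ?mulr0.
by move=> i /negPf ig; rewrite ffunE ig mul0r.
Qed.

End GroupRing.

Section FiniteGroupRing.
Variables (F : finFieldType) (gT : finGroupType).
Local Notation FG := (group_ring_of F gT).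

HB.instance Definition _ := Finite.copy FG {ffun gT -> F}.
(* GRing.unit is the set of two-sided invertible elements, see FG_unitP. *)
HB.instance Definition _ := FinRing.isNzRing.Build FG.

Lemma FG_unitP (x : FG) :
  reflect (exists y, x * y = 1 /\ y * x = 1) (x \is a GRing.unit).
Proof.
by apply: (iffP idP) => [/unitrP|] [y [yx xy]]; [|apply/unitrP]; exists y.
Qed.

End FiniteGroupRing.

Definition expgz (gT : finGroupType) (g : gT) (v : int) : gT :=
  match v with Posz k => g ^+ k | Negz k => g ^- k.+1 end%g.

Section Expgz.
Variable gT : finGroupType.
Implicit Types (g : gT) (v w : int).

Lemma expgz_nat g v : exists k : nat,
  expgz g v = (g ^+ k)%g /\ (k%:Z = v %[mod #[g]%g])%Z.
Proof.
case: v => k; first by exists k.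
exists (k.+1 * #[g].-1)%N; split.
  by rewrite /expgz mulnC expgM -invg_expg expgVn.
apply/eqP; rewrite eqz_mod_dvd NegzE opprK -PoszD addnC -mulnS prednK ?order_gt0 //.
by rewrite PoszM dvdz_mull.
Qed.

Lemma expgz_expgz g v : (v ^+ 2 = 1 %[mod exponent [set: gT]])%Z ->
  expgz (expgz g v) v = g.
Proof.
move=> v2; have [k [-> kv]] := expgz_nat g v.
have [l [-> lv]] := expgz_nat (g ^+ k)%g v.
have dvo (h : gT) : (#[h]%g %| exponent [set: gT])%N.
  by apply: dvdn_exponent; rewrite inE.
have v2g : (v * v = 1 %[mod #[g]%g])%Z.
  apply/eqP; move/eqP: v2; rewrite !eqz_mod_dvd -expr2; apply: dvdz_trans.
  exact: dvo.
have kv2 : (k%:Z * v = 1 %[mod #[g]%g])%Z.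
  by rewrite -modzMml kv modzMml.
have cop : coprime #[g]%g k.
  have : (#[g]%g%:Z %| k%:Z * v - 1)%Z by rewrite -eqz_mod_dvd kv2.
  case/dvdzP=> c /eqP; rewrite subr_eq => /eqP e.
  rewrite -[coprime _ _]/(coprimez #[g]%g%:Z k%:Z).
  apply/coprimezP; exists (- c, v) => /=.
  by rewrite [v * _]mulrC e mulNr addKr.
have ogk : #[g ^+ k]%g = #[g]%g by rewrite orderXgcd (eqP cop) divn1.
rewrite -expgM -[RHS]expg1; apply/eqP; rewrite eq_expg_mod_order.
rewrite -eqz_nat -!modz_nat PoszM -modzMmr -ogk lv ogk modzMmr.
exact/eqP.
Qed.

Hypothesis abG : abelian [set: gT].

Lemma abelT_mulgC (g h : gT) : (g * h = h * g)%g.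
Proof. by apply: (centsP abG); rewrite inE. Qed.

Lemma expgzM g h v : expgz (g * h)%g v = (expgz g v * expgz h v)%g.
Proof.
have c : commute g h by exact: abelT_mulgC.
case: v => k /=; rewrite expgMn // invMg; exact: abelT_mulgC.
Qed.

Lemma expgzV g v : expgz g^-1 v = (expgz g v)^-1%g.
Proof. by case: v => k /=; rewrite expgVn. Qed.

End Expgz.

Definition sigma1_fun (R : nzRingType) (gT : finGroupType) (v : int)
    (x : group_ring_of R gT) : group_ring_of R gT :=
  \sum_(g : gT) gr_mono (x g) (expgz g v).

Section Sigma.
Variables (F : finFieldType) (gT : finGroupType) (v : int).
Hypothesis abG : abelian [set: gT].
Hypothesis v2 : (v ^+ 2 = 1 %[mod exponent [set: gT]])%Z.
Local Notation FG := (group_ring_of F gT).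
Local Notation sigma := (@sigma1_fun F gT v).

Lemma sigma1_funE (x : FG) g : sigma x g = x (expgz g v).
Proof.
rewrite /sigma1_fun.
rewrite (@sum_ffunE _ _ _ _ _ (fun g => gr_mono (x g) (expgz g v))).
rewrite (bigD1 (expgz g v)) //= ffunE expgz_expgz // eqxx big1 ?addr0 // => h hg.
rewrite ffunE; case: eqP => // e.
by move: hg; rewrite e expgz_expgz ?eqxx.
Qed.

Lemma sigma1D x y : sigma (x + y) = sigma x + sigma y.
Proof. by apply/ffunP=> g; rewrite ffunE !sigma1_funE ffunE. Qed.

Lemma sigma1K x : sigma (sigma x) = x.
Proof. by apply/ffunP=> g; rewrite !sigma1_funE expgz_expgz. Qed.

Lemma sigma1M x y : sigma (x * y) = sigma y * sigma x.
Proof.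
apply/ffunP=> g; rewrite sigma1_funE !gr_mulE.
have inj : injective (fun h : gT => expgz (h^-1 * g)%g v).
  move=> h k /(congr1 (fun t => expgz t v)); rewrite !expgz_expgz //.
  by move/mulIg/invg_inj.
rewrite (reindex_inj inj) /=; apply: eq_bigr => h _.
rewrite !sigma1_funE mulrC; congr (y _ * _).
rewrite !expgzM // !expgzV // invMg invgK.
by rewrite [X in (X * _)%g](abelT_mulgC abG) mulgKV.
Qed.

Definition sigma1 : ring_involution FG :=
  RingInvolution sigma1D sigma1M sigma1K.

End Sigma.

Arguments sigma1 F {gT v} abG v2.

(* Main.v *)
Require Import Defs.
From HB Require Import structures.
From mathcomp Require Import all_boot all_order all_algebra all_fingroup all_solvable.
From mathcomp Require Import finfield ring.

(** Write q for the order of F, m for the exponent of H, star for sigma_1 and A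
    for the group ring.

    In a finite commutative ring, being star-clean means that every idempotent
    is fixed by the involution ([star_clean_idem]): the only clean
    decomposition of [1 - e] uses the idempotent [e] itself, and conversely
    every element is clean because one of its powers is idempotent. So the
    question is when star fixes all idempotents of A.

    Since A has characteristic p and its scalars satisfy a^q = a, the q^n-th
    power of a sum of terms a_g g is the sum of the a_g g^(q^n)
    ([Frobenius_sum_mono]).

    If q^t = v modulo m, let e be idempotent. Then e = e^(q^s) for every s, and
    for s large all g^(q^s) lie in H, where the v-th power is the q^t-th power;
    hence star e = e^(q^(s+t)) = e ([sigma1_idem_fixed]).

    Conversely, suppose that star fixes all idempotents. An element x with
    x^q = x is a root of the product of the X - c over the scalars c, so it is
    an F-linear combination of idempotents and is fixed too
    ([star_Frobenius_fixed]). The group H contains an element h of order m;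
    because q, a power of p, is prime to m, raising to the power q permutes the orbit of h
    under this same operation, and the sum over the orbit is such an x. That
    star fixes it means that h^v lies in the orbit, so h^v = h^(q^t) for some t
    ([sigma1_orbit]). *)

Set Implicit Arguments.
Unset Strict Implicit.
Unset Printing Implicit Defensive.

Import GroupScope GRing.Theory.
Local Open Scope ring_scope.

(** * Cleanness of finite commutative rings *)

(** Two of the powers [x ^+ i] coincide, so the sequence of powers is
    eventually periodic; a multiple [k] of the period past the preperiod gives
    [x ^+ (k + k) = x ^+ k]. *)
Lemma finite_ring_idem_power (R : finNzRingType) (x : R) :
  exists2 k, (0 < k)%N & x ^+ k * x ^+ k = x ^+ k.
Proof.
pose f (i : 'I_#|R|.+1) := x ^+ i.
have /injectivePn[i [j ij fij]] : ~~ injectiveb f.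
  by apply/injectiveP => /leq_card; rewrite card_ord ltnn.
wlog lt_ij : i j ij fij / (i < j)%N.
  move=> W; case: (ltngtP i j) => [lt|lt|e]; first exact: (W i j).
    by apply: (W j i) => //; rewrite eq_sym.
  by move: ij; rewrite -val_eqE /= e eqxx.
pose d := (j - i)%N; have d0 : (0 < d)%N by rewrite subn_gt0.
have per1 a : (i <= a)%N -> x ^+ (a + d) = x ^+ a.
  move=> ia; rewrite -(subnK ia) -addnA subnKC ?(ltnW lt_ij) //.
  by rewrite !exprD -[x ^+ j]fij.
have per a n : (i <= a)%N -> x ^+ (a + n * d) = x ^+ a.
  move=> ia; elim: n => [|n IH]; first by rewrite addn0.
  by rewrite mulSnr addnA per1 // (leq_trans ia) // leq_addr.
exists (i.+1 * d)%N; first by rewrite muln_gt0.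
by rewrite -exprD per // (leq_trans (leqnSn i)) // leq_pmulr.
Qed.

(** Multiplication by [r] is injective, hence surjective by finiteness. *)
Lemma finite_regular_unit (R : finComUnitRingType) (r : R) :
  (forall y, y * r = 0 -> y = 0) -> r \is a GRing.unit.
Proof.
move=> reg; have inj : injective (fun y : R => y * r).
  move=> y z /eqP; rewrite -subr_eq0 -mulrBl => /eqP/reg/eqP.
  by rewrite subr_eq0 => /eqP.
by apply/unitrPr; exists (invF inj 1); rewrite mulrC (f_invF inj 1).
Qed.

(** The element [1 - e] has [e] as its only clean idempotent: on the factor cut
    out by [e] it vanishes, which forces the idempotent to be [1] there, and on
    the complementary factor it is [1], which forces the idempotent to be [0].
    Conversely, some power of [x] is an idempotent [f]; since [x] is invertible
    on the factor cut out by [f] and nilpotent on the other one, [x - (1 - f)]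
    is a unit. *)
Lemma star_clean_idem (R : finComUnitRingType) (star : ring_involution R) :
  star_clean star <-> (forall e : R, e * e = e -> star e = e).
Proof.
split=> [clean e ee | fixed x].
  have [u [f [Uu [stf]]]] := clean (1 - e); rewrite expr2 => ff eq_uf.
  have def_u : u = 1 - e - f by rewrite eq_uf addrK.
  (* The annihilation of [e * (1 - f)] says that [e <= f] as idempotents. *)
  have e_le_f : e * (1 - f) = 0.
    apply: (mulIr Uu); rewrite mul0r def_u.
    transitivity ((e - e * e) * (1 - f) - e * (f - f * f)); first ring.
    by rewrite ee ff !subrr mul0r mulr0 subrr.
  have f_le_e : (1 - e) * f = 0.
    apply: (mulIr Uu); rewrite mul0r def_u.
    transitivity ((f - f * f) * (1 - e) - (e - e * e) * f); first ring.
    by rewrite ee ff !subrr !mul0r subrr.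
  suff <- : f = e by [].
  apply: subr0_eq; transitivity ((1 - e) * f - e * (1 - f)); first ring.
  by rewrite e_le_f f_le_e subrr.
have [k k0] := finite_ring_idem_power x; set f := x ^+ k => ff.
have gg : (1 - f) * (1 - f) = 1 - f.
  by rewrite mulrBl mul1r mulrBr mulr1 ff subrr subr0.
exists (x - (1 - f)), (1 - f); split; last by rewrite subrK.
  apply: finite_regular_unit => y yr0.
  have yx : y * x = y * (1 - f).
    by apply/eqP; rewrite -subr_eq0 -mulrBr yr0.
  have yf0 : y * f = 0.
    have yfx : y * f * x = 0.
      by rewrite mulrAC yx -mulrA mulrBl mul1r ff subrr mulr0.
    by rewrite -ff mulrA {2}/f -(prednK k0) exprS mulrA yfx mul0r.
  have yx1 : y * x = y by rewrite yx mulrBr mulr1 yf0 subr0.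
  have <- : y * f = y.
    by rewrite /f; elim: (k) => [|i IH]; rewrite ?mulr1 // exprS mulrA yx1.
  exact: yf0.
by split; [exact: fixed | rewrite expr2].
Qed.

(** * Elements fixed by Frobenius *)

Lemma expf_cardX (F : finFieldType) (a : F) s : a ^+ (#|F| ^ s) = a.
Proof. by elim: s => [|s IH]; rewrite ?expr1 // expnSr exprM IH expf_card. Qed.

Lemma card_finField_pcharnat (F : finFieldType) (R : nzRingType)
    (phi : {rmorphism F -> R}) : [pchar R].-nat #|F|.
Proof.
have [p _ charF] := finPcharP F.
rewrite (eq_pnat _ (pcharf_eq (rmorph_pchar phi charF))) -cardsT.
exact: abelem_pgroup (fin_ring_pchar_abelem charF).
Qed.

Lemma star0 (R : pzRingType) (star : ring_involution R) : star 0 = 0.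
Proof. by apply: (addrI (star 0)); rewrite -starD !addr0. Qed.

(** For each scalar [c], the element [e_c = 1 - (x - c) ^+ (q - 1)] is the
    idempotent cutting out the factor on which [x] equals [c], so
    [x * e_c = c * e_c]. If [star] fixes [e_c] and the scalars, then also
    [star x * e_c = c * e_c], so [x - star x] is multiplied by 1 under
    [(x - c) ^+ (q - 1)]. Taking the product over all [c] gives a power of
    [x ^+ q - x = 0]. *)
Lemma star_Frobenius_fixed (F : finFieldType) (R : comNzRingType)
    (phi : {rmorphism F -> R}) (star : ring_involution R) :
  (forall c, star (phi c) = phi c) -> (forall e, e * e = e -> star e = e) ->
  forall x, x ^+ #|F| = x -> star x = x.
Proof.
move=> star_phi star_idem x xq; set w := x - star x.
suff : w = 0 by move/subr0_eq.
have q1 : #|F|.-1.+1 = #|F| by apply: prednK; apply: ltnW; exact: finNzRing_gt1.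
have r0 : (0 < #|F|.-1)%N by rewrite -ltnS q1 finNzRing_gt1.
set r := #|F|.-1 in q1 r0.
pose ev := horner_morph (fun c => mulrC x (phi c)).
(* Evaluate at [x] the factorization of [X ^ q - X] over [F]. *)
have ev_prod : \prod_c (x - phi c) = 0.
  have := congr1 ev (finField_genPoly F).
  rewrite /ev rmorphB rmorphXn /= horner_morphX xq subrr rmorph_prod => ->.
  by apply: eq_bigr => c _; rewrite rmorphB /= horner_morphX horner_morphC.
have fix_c c : (x - phi c) ^+ r * w = w.
  rewrite -rmorphN; set z := x + phi (- c).
  have zr : z ^+ r * z = z.
    rewrite -exprSr q1 exprDn_pchar ?(card_finField_pcharnat phi) //.
    by rewrite xq -rmorphXn /= expf_card.
  have zr_idem : z ^+ r * z ^+ r = z ^+ r.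
    by rewrite -{2 3}(prednK r0) !exprS mulrA zr.
  set e := 1 - z ^+ r.
  have star_e : star e = e.
    by apply: star_idem; rewrite mulrBl mul1r mulrBr mulr1 zr_idem subrr subr0.
  have ze : z * e = 0 by rewrite mulrBr mulr1 [z * _]mulrC zr subrr.
  have star_ze : (star x + phi (- c)) * e = 0.
    by rewrite -star_phi -starD -star_e mulrC -starM ze star0.
  have : e * w = 0.
    have -> : w = z - (star x + phi (- c)) by rewrite opprD addrACA subrr addr0.
    by rewrite mulrC mulrBl ze star_ze subrr.
  by rewrite mulrBl mul1r => /subr0_eq.
have : (\prod_c (x - phi c)) ^+ r * w = w.
  rewrite -prodrXl; elim/big_rec: _ => [|c z _ IH]; first by rewrite mul1r.
  by rewrite -mulrA IH.
by rewrite ev_prod expr0n eqn0Ngt r0 mul0r.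
Qed.

(** * The group ring of a finite abelian group *)

Lemma expgzE (gT : finGroupType) (g : gT) (v : int) n :
  expgz g v = (g ^+ n)%g <-> (n%:Z = v %[mod #[g]%g])%Z.
Proof.
have [k [-> <-]] := expgz_nat g v; split=> [/esym/eqP | e].
  by rewrite eq_expg_mod_order -eqz_nat -!modz_nat => /eqP.
by apply/esym/eqP; rewrite eq_expg_mod_order -eqz_nat -!modz_nat e.
Qed.

(** Commutativity needs the hypothesis on the group, so the commutative ring
    structure is attached to a copy of the group ring indexed by its proof. *)
Definition abelian_group_ring (F : finFieldType) (gT : finGroupType)
  of abelian [set: gT] : Type := group_ring_of F gT.

Section AbelianGroupRing.
Variables (F : finFieldType) (gT : finGroupType) (abG : abelian [set: gT]).
Local Notation FG := (abelian_group_ring F abG).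
Local Notation q := #|F|.

Lemma gr_mulC : commutative (@gr_mul F gT).
Proof.
move=> x y; apply/ffunP=> g; rewrite !ffunE.
have inj : injective (fun h : gT => (h^-1 * g)%g) by move=> h k /mulIg/invg_inj.
rewrite (reindex_inj inj) /=; apply: eq_bigr => h _.
by rewrite mulrC invMg invgK (abelT_mulgC abG) mulgA mulgV mul1g.
Qed.

HB.instance Definition _ := FinRing.UnitRing.on FG.
HB.instance Definition _ := GRing.PzRing_hasCommutativeMul.Build FG gr_mulC.

Definition gr_scalar (c : F) : FG := gr_mono c 1%g.

Lemma gr_scalar_zmod_morphism : zmod_morphism gr_scalar.
Proof.
by move=> a b; apply/ffunP=> h; rewrite !ffunE; case: eqP; rewrite ?subrr.
Qed.

Lemma gr_scalar_monoid_morphism : monoid_morphism gr_scalar.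
Proof. by split=> // a b; rewrite [RHS]gr_monoM mulg1. Qed.

HB.instance Definition _ :=
  GRing.isZmodMorphism.Build F FG gr_scalar gr_scalar_zmod_morphism.
HB.instance Definition _ :=
  GRing.isMonoidMorphism.Build F FG gr_scalar gr_scalar_monoid_morphism.

Lemma gr_monoX a g n : (gr_mono a g : FG) ^+ n = gr_mono (a ^+ n) (g ^+ n)%g.
Proof.
elim: n => [|n IH] //.
by rewrite exprS IH [LHS]gr_monoM -exprS -expgS.
Qed.

Lemma Frobenius_sum_mono (I : finType) (A : {pred I}) (a : I -> F)
    (g : I -> gT) s :
  (\sum_(i in A) gr_mono (a i) (g i) : FG) ^+ (q ^ s)
    = \sum_(i in A) gr_mono (a i) (g i ^+ (q ^ s))%g.
Proof.
have qs : [pchar FG].-nat (q ^ s)%N.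
  by rewrite pnatX (card_finField_pcharnat gr_scalar).
have q0 : (0 : FG) ^+ (q ^ s) = 0.
  by rewrite expr0n expn_eq0 -leqn0 leqNgt (ltnW (finNzRing_gt1 F)).
rewrite (big_morph (fun x : FG => x ^+ (q ^ s))
                   (fun x y => exprDn_pchar x y qs) q0).
by apply: eq_bigr => i _; rewrite gr_monoX expf_cardX.
Qed.

Variables (v : int) (v2 : (v ^+ 2 = 1 %[mod exponent [set: gT]])%Z).
Local Notation star := (sigma1 F abG v2).

Lemma sigma1_mono a g : star (gr_mono a g) = gr_mono a (expgz g v).
Proof.
rewrite /= /sigma1_fun (bigD1 g) //= ffunE eqxx big1 ?addr0 // => h /negPf gh.
by apply/ffunP=> k; rewrite !ffunE gh; case: ifP.
Qed.

Lemma sigma1_sum_mono (I : finType) (A : {pred I}) (a : I -> F) (g : I -> gT) :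
  star (\sum_(i in A) gr_mono (a i) (g i))
    = \sum_(i in A) gr_mono (a i) (expgz (g i) v).
Proof.
rewrite (big_morph _ (starD star) (star0 star)).
by apply: eq_bigr => i _; exact: sigma1_mono.
Qed.

(** An idempotent [e] equals [e ^+ (q ^ s)], the sum of the [e g] times
    [g ^+ (q ^ s)], which is supported on [H]. There raising to the power [v] is
    the same as raising to the power [q ^ t], so that [star e] is
    [e ^+ (q ^ (s + t))], which is again [e]. *)
Lemma sigma1_idem_fixed (H : {set gT}) s t (e : FG) :
  (forall g : gT, (g ^+ (q ^ s))%g \in H) ->
  ((q ^ t)%N%:Z = v %[mod exponent H])%Z ->
  e * e = e -> star e = e.
Proof.
move=> toH qt ee.
have idemX n : e ^+ (q ^ n) = e.
  have : (0 < q ^ n)%N by rewrite expn_gt0 (ltnW (finNzRing_gt1 F)).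
  case: (q ^ n)%N => // m _; elim: m => [|m IH] //.
  by rewrite exprS IH.
have sumE n : e = \sum_(g in gT) gr_mono (e g) (g ^+ (q ^ n))%g :> FG.
  rewrite -{1}(idemX n) {1}(gr_sum_monoE e).
  exact: (Frobenius_sum_mono _ _ id).
rewrite {1}(sumE s) sigma1_sum_mono [RHS](sumE (s + t)%N).
apply: eq_bigr => g _; congr gr_mono.
rewrite expnD expgM; apply/expgzE.
apply/eqP; rewrite eqz_mod_dvd; move/eqP: qt; rewrite eqz_mod_dvd.
by apply: dvdz_trans; apply: dvdn_exponent.
Qed.

(** The sum of the orbit of [h] under [g |-> g ^+ q] is its own [q]-th power,
    hence is fixed by [star], which says that the orbit contains [expgz h v]. *)
Lemma sigma1_orbit (h : gT) :
  coprime #[h]%g q -> (forall e : FG, e * e = e -> star e = e) ->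
  exists t, (0 < t)%N /\ ((q ^ t)%N%:Z = v %[mod #[h]%g])%Z.
Proof.
move=> co_hq fixed; pose frob (g : gT) := (g ^+ q)%g.
have iter_frob n : iter n frob h = (h ^+ (q ^ n))%g.
  by elim: n => [|n IH] //=; rewrite IH /frob -expgM expnSr.
pose O := [set g | fconnect frob h g].
have inO g : g \in O -> exists n, g = iter n frob h.
  by rewrite inE => /iter_findex <-; exists (findex frob h g).
have frob_inj : {in O &, injective frob}.
  apply: (can_in_inj (g := fun g => (g ^+ expg_invn <[h]> q)%g)) => g /inO[n ->].
  by rewrite iter_frob /frob (expgK co_hq) // mem_cycle.
(* Injective on [O] and mapping [O] into itself, [frob] permutes [O]; this also
   lets the exponent [t] be chosen positive below. *)
have frobO : frob @: O = O.
  apply/eqP; rewrite eqEcard card_in_imset // leqnn andbT.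
  apply/subsetP=> _ /imsetP[g /inO[n ->] ->].
  by rewrite inE -iterS fconnect_iter.
pose x : FG := \sum_(g in O) gr_mono 1 g.
have xE g : x g = (g \in O)%:R.
  rewrite /x (@sum_ffunE _ _ _ _ _ (fun k => gr_mono 1 k)).
  have [gO | gO] := boolP (g \in O).
    rewrite (bigD1 g) //= ffunE eqxx big1 ?addr0 // => k /andP[_ /negPf kg].
    by rewrite ffunE eq_sym kg.
  by rewrite big1 // => k kO; rewrite ffunE; case: eqP gO => // ->; rewrite kO.
have xq : x ^+ q = x.
  rewrite -[q in LHS]expn1 /x (Frobenius_sum_mono _ _ id) expn1.
  by rewrite -(big_imset (fun g => gr_mono 1 g) frob_inj) frobO.
have star_scalar c : star (gr_scalar c) = gr_scalar c.
  by rewrite sigma1_mono; congr gr_mono; case: (v) => k; rewrite /= expg1n ?invg1.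
have := @star_Frobenius_fixed F FG gr_scalar star star_scalar fixed x xq.
move/ffunP/(_ h); rewrite sigma1_funE // !xE [h \in O]inE connect0.
case: (boolP (_ \in O)) => [|_ /eqP]; last by rewrite eq_sym oner_eq0.
rewrite -{1}frobO => /imsetP[_ /inO[n ->]] + _; rewrite -iterS iter_frob.
by move/expgzE=> vn; exists n.+1.
Qed.

End AbelianGroupRing.

Theorem theorem1p1 (F : finFieldType) (p : nat) (gT : finGroupType)
    (P H : {group gT}) (v : int)
    (charF : p \in [pchar F]%R)
    (abG : abelian [set: gT])
    (sylP : (p.-Sylow([set: gT]) P)%g)
    (defG : (P \x H)%g = [set: gT])
    (v2 : (v ^+ 2 = 1 %[mod exponent [set: gT]])%Z)
    (v1 : (v <> 1 %[mod exponent [set: gT]])%Z) :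
  star_clean (sigma1 F abG v2) <->
  (exists t : nat, (0 < t)%N /\ (#|F|%:Z ^+ t = v %[mod exponent H])%Z).
Proof.
have pnatq : p.-nat #|F|.
  by rewrite -(eq_pnat _ (pcharf_eq charF)) (card_finField_pcharnat idfun).
have p'H : p^'.-nat #|H|.
  have -> : #|H| = (#|[set: gT]|`_p^')%N.
    apply/eqP; rewrite -(eqn_pmul2l (cardG_gt0 P)).
    rewrite (dprod_card (G := [set: gT]%G)) //.
    by rewrite (card_Hall sylP) partnC // cardG_gt0.
  exact: part_pnat.
have qX t : #|F|%:Z ^+ t = (#|F| ^ t)%N%:Z.
  by elim: t => [|t IH] //; rewrite exprS IH -PoszM -expnS.
apply: iff_trans (@star_clean_idem (abelian_group_ring F abG) (sigma1 F abG v2)) _.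
split=> [fixed | [t [_]]].
  have [h Hh ->] := exponent_witness (abelian_nil (abelianS (subsetT H) abG)).
  suff [t [t0 qt]] : exists t, (0 < t)%N /\
      ((#|F| ^ t)%N%:Z = v %[mod #[h]%g])%Z by exists t; rewrite qX.
  apply: sigma1_orbit fixed.
  rewrite coprime_sym; apply: pnat_coprime pnatq _.
  exact: pnat_dvd (order_dvdG Hh) p'H.
rewrite qX => qt e.
(* [H] is reached once [q ^ s] kills the Sylow subgroup. *)
have [s sP] : exists s, (#|P| %| #|F| ^ s)%N.
  have [j ->] := p_natP (pHall_pgroup sylP).
  have [k qE] := p_natP pnatq; exists j; rewrite qE -expnM dvdn_exp2l //.
  rewrite leq_pmull // lt0n; apply: contraTneq (finNzRing_gt1 F) => k0.
  by rewrite qE k0.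
apply: (@sigma1_idem_fixed _ _ _ _ _ H s) qt => g.
have [a [b [Pa Hb -> _]]] := mem_dprod defG (in_setT g).
rewrite expgMn; last exact: abelT_mulgC.
have /dvdnP[c ->] := sP.
by rewrite mulnC {1}expgM expg_cardG // expg1n mul1g groupX.
Qed.
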